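(* Let $K\colon\mathbb{R}^2\times\mathbb{R}^2\to\mathbb{C}$ be a continuous isotropic positive definite kernel, with unique associated kernels $\alpha_n^2$, $n\in\mathbb{N}_0$, on $[0,\infty)$ as defined in the context. Then each of the following conditions is necessary for $K$ to be strictly positive definite: (i) $\alpha_0^2(0,0)>0$, and for any $m\in\mathbb{N}$, distinct $r_1,\dots,r_m\in(0,\infty)$ and $c\in\mathbb{C}^m\setminus\{0\}$ the set $$\Bigl\{n\in\mathbb{Z} : \sum_{i,j=1}^m c_i\overline{c_j}\,\alpha_{|n|}^2(r_i,r_j)>0\Bigr\}$$ intersects every full arithmetic progression in $\mathbb{Z}$. (ii) $\alpha_0^2(0,0)>0$, and for each full arithmetic progression $S$ in $\mathbb{Z}$ the kernel $$(r,s)\mapsto\sum_{n\in S}\alpha_{|n|}^2(r,s),\qquad r,s\in(0,\infty),$$ is strictly positive definite on $(0,\infty)$. The following condition is sufficient for strict positive definiteness of $K$: (iii) $\alpha_0^2(0,0)>0$, and the set $\{n\in\mathbb{Z} : \alpha_{|n|}^2\text{ is strictly positive definite on }(0,\infty)\}$ intersects every full arithmetic progression in $\mathbb{Z}$.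
   Context: A positive definite kernel on a set $X$ is a function $K\colon X\times X\to\mathbb{C}$ such that $\sum_{i,j=1}^m c_i\overline{c_j}K(x_i,x_j)\ge 0$ for all $m\in\mathbb{N}$, $x_1,\dots,x_m\in X$, $c\in\mathbb{C}^m$. It is strictly positive definite on a subset $A\subseteq X$ (on $X$, if no subset is named) if the inequality is strict whenever $x_1,\dots,x_m\in A$ are distinct and $c\neq 0$. A kernel $K$ on $\mathbb{R}^2$ is isotropic if $K(Ux,Uy)=K(x,y)$ for all orthogonal $U\in O(2)$ and $x,y\in\mathbb{R}^2$. A full arithmetic progression in $\mathbb{Z}$ is a set of the form $k\mathbb{Z}+m$ with $k\in\mathbb{N}$, $k\ge1$, and $m\in\{0,\dots,k-1\}$. Associated kernels $\alpha_n^2$ (the superscript $2$ denotes the dimension, not a power): with $T_n$ the Chebyshev polynomials of the first kind, $T_n(\cos\theta)=\cos(n\theta)$, every continuous isotropic positive definite kernel $K$ on $\mathbb{R}^2$ can be written as $K(x,y)=\sum_{n=0}^\infty\alpha_n^2(\|x\|,\|y\|)\,T_n(\langle\frac{x}{\|x\|},\frac{y}{\|y\|}\rangle)$ for $x,y\neq0$, and $K(x,y)=\alpha_0^2(\|x\|,\|y\|)$ if $x=0$ or $y=0$, where $\alpha_n^2\colon[0,\infty)^2\to\mathbb{C}$ are the unique continuous positive definite kernels on $[0,\infty)$ satisfying this together with: (a) for every $r\ge0$ there is a neighborhood $U_r\subset[0,\infty)$ of $r$ with $\sup_{s\in U_r}\sum_{n\ge N}\alpha_n^2(s,s)\to0$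 as $N\to\infty$; (b) $\alpha_n^2(r,0)=\alpha_n^2(0,r)=0$ for all $n\ge1$, $r\ge0$. *)

(* Defs.v *)
From HB Require Import structures.
From mathcomp Require Import all_boot all_order all_algebra.
From mathcomp Require Import all_classical all_reals all_analysis.
From mathcomp Require Import complex ring.
From mathcomp.analysis.showcase Require summability.

Set Implicit Arguments.
Unset Strict Implicit.
Unset Printing Implicit Defensive.

Import Order.TTheory GRing.Theory Num.Theory.
Import numFieldNormedType.Exports.

Local Open Scope classical_set_scope.
Local Open Scope ring_scope.

(* The field R[i], packed as a numClosedFieldType so that it carries the
   topology and norm MathComp-Analysis attaches to every numFieldType.
   In its order, 0 <= z means that z is real and nonnegative. *)
Definition Cplx (R : realType) : numClosedFieldType := R[i].

Section Kernels.
Variables (C : numClosedFieldType) (X : Type).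
Implicit Types (A : set X) (K : X -> X -> C).

Definition kernel_form K m (x : 'I_m -> X) (c : 'rV[C]_m) : C :=
  \sum_(i < m) \sum_(j < m) c 0 i * (c 0 j)^* * K (x i) (x j).

Definition pos_def_on A K : Prop :=
  forall m (x : 'I_m -> X) (c : 'rV[C]_m),
    (forall i, A (x i)) -> 0 <= kernel_form K x c.

Definition strictly_pos_def_on A K : Prop :=
  pos_def_on A K /\
  forall m (x : 'I_m -> X) (c : 'rV[C]_m),
    (forall i, A (x i)) -> injective x -> c != 0 -> 0 < kernel_form K x c.

End Kernels.

(* The norm `|x| of MathComp-Analysis on matrices is the sup norm, hence the
   explicit Euclidean norm. *)
Definition dot (R : realType) n (x y : 'cV[R]_n) : R :=
  \sum_(i < n) x i 0 * y i 0.

Definition enorm (R : realType) n (x : 'cV[R]_n) : R := Num.sqrt (dot x x).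

Definition orthogonal_mx (R : realType) n (U : 'M[R]_n) : Prop :=
  U^T *m U = 1%:M.

Definition isotropic (R : realType) (K : 'cV[R]_2 -> 'cV[R]_2 -> Cplx R) :=
  forall U : 'M[R]_2, orthogonal_mx U ->
  forall x y : 'cV[R]_2, K (U *m x) (U *m y) = K x y.

Fixpoint chebyshevT (R : realType) (n : nat) : {poly R} :=
  match n with
  | 0 => 1
  | 1 => 'X
  | (n2.+1 as n1).+1 => 2%:R *: 'X * chebyshevT R n1 - chebyshevT R n2
  end.

Lemma chebyshevT_cos (R : realType) n (t : R) :
  (chebyshevT R n).[cos t] = cos (n%:R * t).
Proof.
suff: (chebyshevT R n).[cos t] = cos (n%:R * t) /\
      (chebyshevT R n.+1).[cos t] = cos (n.+1%:R * t) by case.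
elim: n => [|n [IH0 IH1]]; first by rewrite hornerE hornerX mul0r cos0 mul1r.
split=> //.
rewrite [chebyshevT _ _]/= hornerD hornerN hornerM hornerZ hornerX IH0.
rewrite -/(chebyshevT R n.+1) IH1.
have -> : n.+2%:R * t = n.+1%:R * t + t :> R by rewrite -natr1 mulrDl mul1r.
have -> : n%:R * t = n.+1%:R * t - t :> R by rewrite -natr1 mulrDl mul1r addrK.
by rewrite cosB cosD; ring.
Qed.

Definition nonneg (R : realType) : set R := `[0, +oo[.
Definition posit (R : realType) : set R := `]0, +oo[.

(* Kernels on [0, +oo[ are functions on the whole of R whose values are only
   used at nonnegative arguments. *)
Record associated_kernels (R : realType) (K : 'cV[R]_2 -> 'cV[R]_2 -> Cplx R)
    (alpha : nat -> R -> R -> Cplx R) : Prop := AssociatedKernels {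
  assoc_continuous : forall n,
    {within @nonneg R `*` @nonneg R, continuous (fun p => alpha n p.1 p.2)};
  assoc_pos_def : forall n, pos_def_on (@nonneg R) (alpha n);
  assoc_series : forall x y : 'cV[R]_2, x != 0 -> y != 0 ->
    series (fun n => alpha n (enorm x) (enorm y) *
      ((chebyshevT R n).[dot ((enorm x)^-1 *: x) ((enorm y)^-1 *: y)])%:C%C)
      @ \oo --> K x y;
  assoc_zero : forall x y : 'cV[R]_2, x = 0 \/ y = 0 ->
    K x y = alpha 0%N (enorm x) (enorm y);
  (* alpha n s s is real and nonnegative by assoc_pos_def, so the tails are
     well-defined elements of [0, +oo] *)
  assoc_locally_uniform : forall r, nonneg r ->
    exists U : set R, [/\ U `<=` @nonneg R, within (@nonneg R) (nbhs r) U &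
      (fun N : nat => ereal_sup
        [set (\sum_(N <= n <oo) (complex.Re (alpha n s s))%:E)%E | s in U])
        @ \oo --> 0%E];
  assoc_origin : forall n r, (1 <= n)%N -> nonneg r ->
    alpha n r 0 = 0 /\ alpha n 0 r = 0
}.

Definition full_progression (S : set int) : Prop :=
  exists k m : nat, [/\ (1 <= k)%N, (m < k)%N &
    S = [set n | exists q : int, n = k%:Z * q + m%:Z]].

(* Unconditional sum over n in S: the limit of the partial sums along the
   finite subsets of int. *)
Definition progression_kernel (R : realType) (alpha : nat -> R -> R -> Cplx R)
    (S : set int) (r s : R) : Cplx R :=
  summability.sum (fun n : int => if n \in S then alpha `|n|%N r s else 0).

(* Main.v *)
Require Import Defs.
From HB Require Import structures.
From mathcomp Require Import all_boot all_order all_algebra.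
From mathcomp Require Import cyclic all_field finmap.
From mathcomp Require Import all_classical all_reals all_analysis.
From mathcomp Require Import complex ring.
From mathcomp.analysis.showcase Require summability.

Set Implicit Arguments.
Unset Strict Implicit.
Unset Printing Implicit Defensive.

Import Order.TTheory GRing.Theory Num.Theory.
Import numFieldNormedType.Exports.

Local Open Scope classical_set_scope.
Local Open Scope ring_scope.

(* Let u_i be the unit complex number pointing in the direction of x_i, and
   Q_n(d) = sum_(i, j) d_i conj(d_j) alpha_n(|x_i|, |x_j|) >= 0. Since
   T_n(Re z) = (z^n + conj(z)^n) / 2 for |z| = 1, the quadratic form of K at
   the points x_i with weights c_i is the series, over n >= 0, of the
   nonnegative terms (Q_n(c u^n) + Q_n(c conj(u)^n)) / 2.

   Necessity: placing the weights c_i w^(-p t) at the points r_i w^t, t < k,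
   with w a primitive k-th root of unity, kills all the terms except those
   with n or -n in kZ + p, where Q_n(c u^n) is proportional to the form of
   alpha_n at (r, c).

   Sufficiency: Q_n(c u^n) > 0 as soon as alpha_n is strictly positive
   definite and, for some radius, f(n) = sum_(|x_i| = radius) c_i u_i^n does
   not vanish. Such an f is not identically zero, hence has no zero on some
   full arithmetic progression: reduce its coefficients and frequencies, in
   the finitely generated ring they span with their inverses, modulo a maximal
   ideal avoiding a nonzero value f(n0). The residue field F is finite, so f is
   (#|F| - 1)-periodic modulo that ideal. *)

(** * Reduction of finitely generated domains to finite fields *)

(** A splitting field of [p] over [F] is again finite. The size hypothesis excludes exactly the
    nonzero constants; for [p = 0] any point is a root. *)
Lemma finite_ext_root (F : finFieldType) (p : {poly F}) : size p != 1%N ->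
  exists (E : finFieldType) (j : {rmorphism F -> E}) (t : E),
    root (map_poly j p) t.
Proof.
have [->|p0 sp1] := eqVneq p 0.
  by exists F, idfun, 0; rewrite map_poly0 root0.
have [L [rs p_rs _]] := FinSplittingFieldFor p0.
exists (FinFieldExtType L), (GRing.in_alg L).
case: rs p_rs => [|z rs] p_rs.
  move: (eqp_size p_rs); rewrite big_nil size_polyC oner_eq0 size_map_poly.
  by move=> sp; rewrite sp in sp1.
by exists z; rewrite (eqp_root p_rs) root_prod_XsubC mem_head.
Qed.

(** A nonzero [p] may vanish on all of [F], but a root of [p - 1] in an extension gives it the value
    1. *)
Lemma finite_ext_nonroot (F : finFieldType) (p : {poly F}) : p != 0 ->
  exists (E : finFieldType) (j : {rmorphism F -> E}) (t : E),
    ~~ root (map_poly j p) t.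
Proof.
move=> p0; have [/size_poly1P[c c0 ->]|sp1] := boolP (size p == 1%N).
  by exists F, idfun, 0; rewrite map_polyC rootC.
have [|E [j [t]]] := @finite_ext_root F (p - 1).
  apply: contra sp1 => /size_poly1P[c c0 /(canRL (subrK _)) pc].
  by rewrite pc -polyCD size_polyC -polyC_eq0 polyCD -pc p0.
rewrite rmorphB rmorph1 => /rootP/eqP; rewrite !hornerE subr_eq0 => /eqP pt.
by exists E, j, t; rewrite /root pt oner_eq0.
Qed.

Definition residually_finite_field (A : nzRingType) :=
  forall g : A, g != 0 ->
    exists (F : finFieldType) (phi : {rmorphism A -> F}), phi g != 0.

Lemma int_residually_finite_field : residually_finite_field int.
Proof.
(* As in Euclid's argument, a prime factor of a factorial plus one is larger than [|g|], so [g] is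
   nonzero modulo [p]. *)
move=> g g0; pose p := pdiv (`|g|%N.+1)`!.+1.
have p_pr : prime p by rewrite pdiv_prime // ltnS fact_gt0.
have ltgp : (`|g| < p)%N.
  rewrite ltnNge; apply/negP => lepg.
  have : (p %| (`|g|.+1)`! + 1)%N by rewrite addn1 pdiv_dvd.
  rewrite dvdn_addr ?dvdn1; first by case: eqP p_pr => // ->.
  by rewrite dvdn_fact // prime_gt0 // leqW.
exists 'F_p, intr; rewrite [g]intEsign rmorphM rmorph_sign mulf_neq0 ?signr_eq0 //.
rewrite -(dvdn_pcharf (pchar_Fp p_pr)); apply/negP => /dvdn_leq.
by rewrite absz_gt0 g0 leqNgt ltgp => /(_ isT).
Qed.

Lemma poly_min_size (A : nzRingType) (P : {poly A} -> Prop) :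
  (exists p, P p) -> exists2 p, P p & forall q, P q -> (size p <= size q)%N.
Proof.
move=> [p0 Pp0]; pose b n := `[< exists2 p, P p & size p = n >].
have bex : exists n, b n by exists (size p0); apply/asboolP; exists p0.
case: (ex_minnP bex) => n /asboolP[p Pp <-] nmin.
by exists p => // q Pq; apply: nmin; apply/asboolP; exists q.
Qed.

Section Adjoin.
Variables (A : comNzRingType) (L : fieldType) (i : {rmorphism A -> L}) (a : L).

Definition poly_value (p : {poly A}) : L := (map_poly i p).[a].

Fact poly_valueB : {morph poly_value : p q / p - q}.
Proof. by move=> p q; rewrite /poly_value rmorphB !hornerE. Qed.
Fact poly_valueM : {morph poly_value : p q / p * q}.
Proof. by move=> p q; rewrite /poly_value rmorphM !hornerE. Qed.
Fact poly_value1 : poly_value 1 = 1.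
Proof. by rewrite /poly_value rmorph1 hornerE. Qed.
HB.instance Definition _ :=
  GRing.isZmodMorphism.Build {poly A} L poly_value poly_valueB.
HB.instance Definition _ :=
  GRing.isMonoidMorphism.Build {poly A} L poly_value (poly_value1, poly_valueM).

Lemma poly_valueC c : poly_value c%:P = i c.
Proof. by rewrite /poly_value map_polyC hornerC. Qed.
Lemma poly_valueX : poly_value 'X = a.
Proof. by rewrite /poly_value map_polyX hornerX. Qed.
Lemma poly_valueZ c p : poly_value (c *: p) = i c * poly_value p.
Proof. by rewrite -mul_polyC rmorphM /= poly_valueC. Qed.

(** This is the ring A[a], realized inside [L] as the image of evaluation at [a]. *)
Definition adjoin : {pred L} := [pred x | `[< exists p, x = poly_value p >]].

Lemma poly_value_adjoin p : poly_value p \in adjoin.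
Proof. by apply/asboolP; exists p. Qed.

Lemma adjoin_subring : subring_closed adjoin.
Proof.
split=> [|x y|x y]; first by rewrite -poly_value1 poly_value_adjoin.
  move=> /asboolP[p ->] /asboolP[q ->].
  by apply/asboolP; exists (p - q); rewrite rmorphB.
move=> /asboolP[p ->] /asboolP[q ->].
by apply/asboolP; exists (p * q); rewrite rmorphM.
Qed.
HB.instance Definition _ := GRing.isSubringClosed.Build L adjoin adjoin_subring.

Record adjoin_ring := AdjoinRing {
  adjoin_val :> L; adjoin_valP : adjoin_val \in adjoin }.
HB.instance Definition _ := [isSub for adjoin_val].
HB.instance Definition _ := [Choice of adjoin_ring by <:].
HB.instance Definition _ := [SubChoice_isSubComNzRing of adjoin_ring by <:].

Lemma adjoin_ringP (x : adjoin_ring) : exists p, val x = poly_value p.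
Proof. by case: x => x /= /asboolP. Qed.

Definition adjoin_poly (x : adjoin_ring) : {poly A} := sval (cid (adjoin_ringP x)).

Lemma adjoin_polyK x : poly_value (adjoin_poly x) = val x.
Proof. by rewrite /adjoin_poly; case: cid. Qed.

Section Extend.
Variables (F : fieldType) (phi : {rmorphism A -> F}) (t : F).
Hypothesis phi_ker : forall p, poly_value p = 0 -> (map_poly phi p).[t] = 0.

(** The homomorphism from A[a] to [F] that extends [phi] and sends [a] to [t]. A representing
    polynomial is chosen arbitrarily; by [phi_ker] every algebraic relation of [a] also holds for
    [t], so the choice does not affect the value. *)
Definition adjoin_ext (x : adjoin_ring) : F := (map_poly phi (adjoin_poly x)).[t].

Lemma adjoin_extE x p : val x = poly_value p -> adjoin_ext x = (map_poly phi p).[t].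
Proof.
move=> xp; apply/eqP; rewrite -subr_eq0 /adjoin_ext -hornerN -hornerD -rmorphB.
by rewrite phi_ker // rmorphB /= adjoin_polyK xp subrr.
Qed.

Fact adjoin_extB : {morph adjoin_ext : x y / x - y}.
Proof.
move=> x y; rewrite (@adjoin_extE _ (adjoin_poly x - adjoin_poly y)).
  by rewrite rmorphB !hornerE.
by rewrite [RHS]rmorphB /= !adjoin_polyK.
Qed.
Fact adjoin_extM : {morph adjoin_ext : x y / x * y}.
Proof.
move=> x y; rewrite (@adjoin_extE _ (adjoin_poly x * adjoin_poly y)).
  by rewrite rmorphM !hornerE.
by rewrite [RHS]rmorphM /= !adjoin_polyK.
Qed.
Fact adjoin_ext1 : adjoin_ext 1 = 1.
Proof. by rewrite (@adjoin_extE _ 1) ?rmorph1 ?hornerE. Qed.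
HB.instance Definition _ :=
  GRing.isZmodMorphism.Build adjoin_ring F adjoin_ext adjoin_extB.
HB.instance Definition _ :=
  GRing.isMonoidMorphism.Build adjoin_ring F adjoin_ext (adjoin_ext1, adjoin_extM).

Lemma adjoin_ext_exists : exists psi : {rmorphism adjoin_ring -> F},
  forall x p, val x = poly_value p -> psi x = (map_poly phi p).[t].
Proof. by exists adjoin_ext; exact: adjoin_extE. Qed.

End Extend.

Hypothesis i_inj : injective i.

Let i_eq0 c : (i c == 0) = (c == 0). Proof. exact: raddf_eq0. Qed.

(** Here A[a] is a polynomial ring: keep the leading coefficient of [p] alive in a finite field,
    then send [a] to a non-root of the reduced polynomial. *)
Lemma adjoin_residually_finite_transcendental :
  (forall p, poly_value p = 0 -> p = 0) -> residually_finite_field A ->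
  residually_finite_field adjoin_ring.
Proof.
move=> atr rfA g g0; have [p gp] := adjoin_ringP g.
have p0 : p != 0 by apply: contra_neq g0 => p0; apply: val_inj; rewrite gp p0 !rmorph0.
have [|F [phi]] := rfA (lead_coef p); first by rewrite lead_coef_eq0.
rewrite -coef_map => lp.
have /finite_ext_nonroot[E [j [t]]] : map_poly phi p != 0.
  by apply: contra_neq lp => ->; rewrite coef0.
rewrite -map_poly_comp => pt.
have [|psi psiE] := @adjoin_ext_exists _ (j \o phi) t.
  by move=> q /atr ->; rewrite rmorph0 horner0.
by exists E, psi; rewrite (psiE _ _ gp).
Qed.

Import Pdiv.Ring Pdiv.ComRing.

(** A relation [q] of least degree serves as minimal polynomial of [a]. Once its leading coefficient
    survives in a finite field, [a] can be sent to a root of the reduction of [q]. *)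
Lemma adjoin_residually_finite_algebraic q0 :
  q0 != 0 -> poly_value q0 = 0 -> residually_finite_field A ->
  residually_finite_field adjoin_ring.
Proof.
move=> q00 q0a rfA g g0.
have [|q [qn0 qa] qmin] :=
  @poly_min_size A (fun q => q != 0 /\ poly_value q = 0); first by exists q0.
have q_min p : poly_value p = 0 -> (size p < size q)%N -> p = 0.
  move=> pa; rewrite ltnNge => spq; apply: contraNeq spq => pn0.
  exact: qmin.
have lqn0 : i (lead_coef q) != 0 by rewrite i_eq0 lead_coef_eq0.
have vg0 : val g != 0 by apply: contra_neq g0 => v0; apply: val_inj; rewrite v0 rmorph0.
(* By pseudo-division, a nonzero multiple of g that is a polynomial value of
   least degree is a constant: g divides a nonzero element of A, which a
   homomorphism to a finite field can be chosen not to kill. *)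
have [|r [ra0 [v rav]] rmin] := @poly_min_size A (fun r =>
    poly_value r != 0 /\ exists v, poly_value r = val g * poly_value v).
  have [p gp] := adjoin_ringP g; exists p; rewrite -gp; split=> //.
  by exists 1; rewrite rmorph1 mulr1.
have rn0 : r != 0 by apply: contra_neq ra0 => ->; rewrite rmorph0.
have lrn0 : i (lead_coef r) != 0 by rewrite i_eq0 lead_coef_eq0.
have sr1 : size r = 1%N.
  (* Modulo [q], the polynomial [r] can be replaced by its pseudo-remainder, whose value is that of
     [r] times a nonzero constant, hence still a nonzero multiple of [g]. *)
  have srq : (size r <= size q)%N.
    apply: (@leq_trans (size (rmodp r q))); last by apply: ltnW; rewrite ltn_rmodp.
    apply: rmin.
    have := congr1 poly_value (rdivp_eq q r); rewrite poly_valueZ rmorphD rmorphM /=.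
    rewrite qa mulr0 add0r => <-; rewrite rmorphXn /= mulf_neq0 ?expf_neq0 //.
    split=> //; exists ((lead_coef q ^+ rscalp r q) *: v).
    by rewrite poly_valueZ rmorphXn /= rav mulrCA.
  (* Now divide [q] by [r]. The value of the remainder is a multiple of [g], so minimality of [r]
     makes it vanish, and minimality of [q] makes the remainder itself zero. The quotient then
     vanishes at [a], so it is at least as long as [q], which forces [r] to be constant. *)
  have := congr1 poly_value (rdivp_eq r q); rewrite poly_valueZ rmorphD rmorphM /=.
  rewrite qa mulr0 => /esym/eqP; rewrite addrC addr_eq0 => /eqP sa.
  have s0 : rmodp q r = 0.
    apply/q_min; last by rewrite (leq_trans _ srq) // ltn_rmodp.
    apply/eqP; apply: contraT => sa0.
    suff : (size r <= size (rmodp q r))%N by rewrite leqNgt ltn_rmodp rn0.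
    apply: rmin; split=> //.
    exists (- (rdivp q r) * v); rewrite sa rmorphM rmorphN /= rav.
    by rewrite [RHS]mulrCA mulNr.
  have ha : poly_value (rdivp q r) = 0.
    apply/eqP; move/eqP: sa; rewrite s0 rmorph0 eq_sym oppr_eq0 mulf_eq0.
    by rewrite (negPf ra0) orbF.
  have := rdivp_eq r q; rewrite s0 addr0 => /(congr1 (map_poly i)).
  rewrite map_polyZ rmorphM /= => qh.
  have iq0 : map_poly i q != 0 by rewrite map_poly_eq0_id0.
  have ir0 : map_poly i r != 0 by rewrite map_poly_eq0_id0.
  have cn0 : i (lead_coef r ^+ rscalp q r) != 0 by rewrite rmorphXn expf_neq0.
  have h0 : rdivp q r != 0.
    apply: contraNneq iq0 => h0; move/eqP: qh.
    by rewrite h0 rmorph0 mul0r scaler_eq0 (negPf cn0).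
  have sqh : (size q <= size (rdivp q r))%N.
    by rewrite leqNgt; apply: contra h0 => /(q_min _ ha) ->.
  have := congr1 (fun p : {poly L} => size p) qh.
  rewrite size_scale // size_mul ?map_poly_eq0_id0 ?i_eq0 ?lead_coef_eq0 //.
  rewrite !size_map_inj_poly ?rmorph0 // => sq.
  have := sqh; rewrite sq -ltnS prednK ?addn_gt0 ?size_poly_gt0 ?h0 //.
  rewrite -[X in (_ <= X)%N -> _]addn1 leq_add2l => sr.
  by apply/eqP; rewrite eqn_leq sr size_poly_gt0 rn0.
have /size_poly1P[d d0 rd] : size r == 1%N by rewrite sr1.
(* Keeping [d] alive protects [g], which divides [d] in A[a]; keeping [lead_coef q] alive makes the
   reduction of [q] nonconstant and its pseudo-division usable after reduction. *)
have [|F [phi]] := rfA (d * lead_coef q).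
  by rewrite -i_eq0 rmorphM mulf_neq0 // i_eq0.
rewrite rmorphM mulf_eq0 negb_or => /andP[phid philq].
have [|E [j [t]]] := @finite_ext_root F (map_poly phi q).
  rewrite size_map_poly_id0 //; apply/eqP => /eqP/size_poly1P[c c0 qc].
  by move/eqP: qa; rewrite qc poly_valueC i_eq0 (negPf c0).
rewrite -map_poly_comp => /rootP qt.
have [|psi psiE] := @adjoin_ext_exists _ (j \o phi) t.
  (* Every relation [p] of [a] is, up to a power of [lead_coef q], a multiple of [q]; as that power
     is nonzero in the field, [p] reduces to a polynomial vanishing at [t]. *)
  move=> p pa; have := rdivp_eq q p.
  have -> : rmodp p q = 0.
    apply: q_min; last by rewrite ltn_rmodp.
    have := congr1 poly_value (rdivp_eq q p).
    by rewrite poly_valueZ rmorphD rmorphM /= pa qa !mulr0 add0r.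
  rewrite addr0 => /(congr1 (map_poly (j \o phi))); rewrite map_polyZ rmorphM /=.
  move=> /(congr1 (fun p => p.[t])); rewrite hornerZ hornerM qt mulr0 => /eqP.
  by rewrite mulf_eq0 !rmorphXn expf_eq0 /= fmorph_eq0 (negPf philq) andbF => /eqP.
exists E, psi; apply: contraNneq phid => psig.
have v_in := poly_value_adjoin v.
have : psi (g * AdjoinRing v_in) = (map_poly (j \o phi) r).[t].
  by apply: psiE; rewrite rav rmorphM.
rewrite rmorphM psig mul0r rd map_polyC hornerC => /esym/eqP.
by rewrite /= fmorph_eq0.
Qed.

Lemma adjoin_residually_finite_field :
  residually_finite_field A -> residually_finite_field adjoin_ring.
Proof.
have [[q q0 qa]|ntr] := pselect (exists2 q, q != 0 & poly_value q = 0).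
  exact: adjoin_residually_finite_algebraic qa.
apply: adjoin_residually_finite_transcendental => p pa.
by apply/eqP; apply: contra_notT ntr => p0; exists p.
Qed.

End Adjoin.

(** Start from the integers, which embed in characteristic 0, and adjoin the elements of [s] one at
    a time. *)
Lemma finite_residue_ring (L : numFieldType) (s : seq L) :
  exists (A : comNzRingType) (i : {rmorphism A -> L}),
    [/\ injective i, residually_finite_field A &
        forall x, x \in s -> exists y, x = i y].
Proof.
elim: s => [|a s [A [i [i_inj rfA sA]]]].
  exists int, intr; split=> //; last exact: int_residually_finite_field.
  exact: intr_inj.
exists (adjoin_ring i a), val; split=> [||x]; first exact: val_inj.
  exact: adjoin_residually_finite_field.
rewrite in_cons => /predU1P[->|/sA[y ->]].
  by exists (AdjoinRing (poly_value_adjoin i a 'X)); rewrite /= poly_valueX.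
by exists (AdjoinRing (poly_value_adjoin i a y%:P)); rewrite /= poly_valueC.
Qed.

(* A weak form of the Skolem-Mahler-Lech theorem: reducing the c j and the
   invertible z j modulo a finite field F in which f n0 survives, the sequence
   f becomes periodic of period #|F|.-1. *)
Lemma power_sum_progression_neq0 (L : numFieldType) (I : finType)
    (c z : I -> L) (n0 : nat) :
  (forall j, z j != 0) -> \sum_j c j * z j ^ n0%:Z != 0 ->
  exists2 k : nat, (0 < k)%N &
    forall q : int, \sum_j c j * z j ^ (k%:Z * q + n0%:Z) != 0.
Proof.
(* The inverses of the [z j] are included so that negative powers also come from [A]. *)
move=> z0 f0; pose s := codom c ++ codom z ++ codom (fun j => (z j)^-1).
have [A [i [i_inj rfA sA]]] := finite_residue_ring s.
have i_eq0 x : (i x == 0) = (x == 0) by exact: raddf_eq0.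
have /choice[c' cE] j : exists y, c j = i y.
  by apply: sA; rewrite mem_cat codom_f.
have /choice[z' zE] j : exists y, z j = i y.
  by apply: sA; rewrite !mem_cat codom_f orbT.
have /choice[w' wE] j : exists y, (z j)^-1 = i y.
  by apply: sA; rewrite !mem_cat (codom_f (fun j => (z j)^-1)) !orbT.
have zpE j (n : int) : z j ^ n = i (if n is Posz m then z' j ^+ m else w' j ^+ `|n|%N).
  case: n => n; first by rewrite rmorphXn /= -zE.
  by rewrite [RHS]rmorphXn NegzE -exprz_inv wE.
have zw j : z' j * w' j = 1.
  by apply: i_inj; rewrite rmorphM rmorph1 /= -zE -wE divff.
pose f' (n : int) := \sum_j c' j * (if n is Posz m then z' j ^+ m else w' j ^+ `|n|%N).
have fE n : \sum_j c j * z j ^ n = i (f' n).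
  by rewrite rmorph_sum; apply: eq_bigr => j _; rewrite rmorphM /= -zpE -cE.
have [|F [phi phif]] := rfA (f' n0%:Z).
  by rewrite -i_eq0 -fE.
have phizw j : phi (z' j) * phi (w' j) = 1 by rewrite -rmorphM zw rmorph1.
have phiz0 j : phi (z' j) != 0.
  by apply/eqP => z'0; have /eqP := phizw j; rewrite z'0 mul0r eq_sym oner_eq0.
have phiw j : phi (w' j) = (phi (z' j))^-1.
  by apply: (mulfI (phiz0 j)); rewrite phizw divff.
have phifE n : phi (f' n) = \sum_j phi (c' j) * phi (z' j) ^ n.
  rewrite rmorph_sum; apply: eq_bigr => j _; rewrite rmorphM /=; congr (_ * _).
  by case: n => n; rewrite rmorphXn //= phiw NegzE -exprz_inv.
have F1 := finRing_gt1 F.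
exists #|F|.-1; first by rewrite -subn1 subn_gt0.
move=> q; rewrite fE i_eq0; apply: contraNneq phif => /(congr1 phi).
rewrite rmorph0 !phifE => fq; apply/eqP; rewrite -[RHS]fq; apply: eq_bigr => j _; congr (_ * _).
rewrite expfzDr // -exprz_exp -[phi (z' j) ^ #|F|.-1]/(phi (z' j) ^+ #|F|.-1).
have -> : phi (z' j) ^+ #|F|.-1 = 1; last by rewrite exp1rz mul1r.
apply: (mulfI (phiz0 j)); rewrite -exprS prednK ?expf_card ?mulr1 //.
exact: ltnW.
Qed.

(** If all power sums vanished, so would the sum of [c i * p.[z i]] for every polynomial [p]. The
    interpolation polynomial vanishing at every node but [z i0] contradicts this. *)
Lemma exponential_sum_neq0 (L : idomainType) (T : finType) (P : pred T) (z c : T -> L) i0 :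
  {in P &, injective z} -> P i0 -> c i0 != 0 ->
  exists n : nat, \sum_(i | P i) c i * z i ^+ n != 0.
Proof.
move=> z_inj Pi0 ci0; pose p := \prod_(i | P i && (i != i0)) ('X - (z i)%:P).
have p_i0 : p.[z i0] != 0.
  rewrite horner_prod; apply/prodf_neq0 => i /andP[Pi ii0].
  by rewrite hornerXsubC subr_eq0; apply: contra_neq ii0 => /z_inj ->.
have sumE : \sum_(i | P i) c i * p.[z i] = c i0 * p.[z i0].
  rewrite (bigD1 i0) //= big1 ?addr0 // => i iP.
  by rewrite horner_prod (bigD1 i) //= hornerXsubC subrr mul0r mulr0.
apply: contrapT => fn0; have : c i0 * p.[z i0] != 0 by rewrite mulf_neq0.
rewrite -sumE => /eqP; apply.
under eq_bigr do rewrite horner_coef mulr_sumr.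
rewrite exchange_big big1 //= => n _.
under eq_bigr do rewrite mulrCA.
rewrite -mulr_sumr; have -> : \sum_(i | P i) c i * z i ^+ n = 0.
  by apply/eqP; apply: contra_notT fn0 => fn; exists n.
by rewrite mulr0.
Qed.

Lemma prim_root_exists (C : numClosedFieldType) n : (0 < n)%N ->
  exists z : C, n.-primitive_root z.
Proof.
move=> n0; have [rs] := closed_field_poly_normal ('X^n - 1 : {poly C}).
rewrite (monicP (monicXnsubC _ n0)) scale1r => rsE.
have rs1 : all n.-unity_root rs by apply/allP => z; rewrite -root_prod_XsubC -rsE.
have size_rs : (n <= size rs)%N.
  by rewrite -ltnS -(size_prod_XsubC rs id) -rsE size_XnsubC.
have uniq_rs : uniq rs.
  by rewrite -separable_prod_XsubC -rsE separable_Xn_sub_1 // pnatr_eq0 -lt0n.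
by have /hasP[z _ z_prim] := has_prim_root n0 rs1 uniq_rs size_rs; exists z.
Qed.

Lemma geometric_sum_eq0 (L : idomainType) (z : L) k :
  z ^+ k = 1 -> z != 1 -> \sum_(i < k) z ^+ i = 0.
Proof.
move=> zk z1; apply/eqP; move/eqP: (subrX1 z k).
by rewrite zk subrr eq_sym mulf_eq0 subr_eq0 (negPf z1).
Qed.

(** * Quadratic forms of kernels *)

Section Forms.
Variables (C : numClosedFieldType) (X : Type).
Implicit Types (T : finType) (A : set X) (K : X -> X -> C).

(** Arbitrary finite index types make it possible to index points by products, subtypes and sets of
    radii. *)
Definition fin_form T K (x : T -> X) (c : T -> C) : C :=
  \sum_i \sum_j c i * (c j)^* * K (x i) (x j).

Lemma fin_form_kernel_form T K (x : T -> X) (c : T -> C) :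
  fin_form K x c = kernel_form K (fun i => x (@enum_val T T i)) (\row_i c (@enum_val T T i)).
Proof.
have enumE F : \sum_i F i = \sum_(i < #|T|) F (@enum_val T T i) :> C.
  exact/reindex/onW_bij/enum_val_bij.
rewrite /fin_form /kernel_form enumE; apply: eq_bigr => i _.
by rewrite enumE; apply: eq_bigr => j _; rewrite !mxE.
Qed.

Lemma fin_form_ge0 A T K (x : T -> X) (c : T -> C) :
  pos_def_on A K -> (forall i, A (x i)) -> 0 <= fin_form K x c.
Proof. by move=> pdK Ax; rewrite fin_form_kernel_form; exact: pdK. Qed.

Lemma fin_form_gt0 A T K (x : T -> X) (c : T -> C) i0 :
  strictly_pos_def_on A K -> (forall i, A (x i)) -> injective x -> c i0 != 0 ->
  0 < fin_form K x c.
Proof.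
move=> [_ spdK] Ax x_inj ci0; rewrite fin_form_kernel_form.
apply: spdK => // [i j /x_inj/enum_val_inj //|].
apply: contra_neq ci0 => /rowP/(_ (enum_rank i0)).
by rewrite !mxE enum_rankK.
Qed.

Lemma fin_form_scale T K (x : T -> X) (b : C) (c : T -> C) :
  fin_form K x (fun i => b * c i) = `|b| ^+ 2 * fin_form K x c.
Proof.
rewrite normCK mulr_sumr; apply: eq_bigr => i _; rewrite mulr_sumr.
by apply: eq_bigr => j _; rewrite rmorphM; ring.
Qed.

(** Coinciding points can be merged, their weights adding up over each fibre of [h]. *)
Lemma fin_form_pushforward (T U : finType) (K : X -> X -> C) (h : T -> U)
    (y : U -> X) (c : T -> C) :
  fin_form K (y \o h) c = fin_form K y (fun u => \sum_(i | h i == u) c i).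
Proof.
rewrite /fin_form (partition_big h predT) //=; apply: eq_bigr => u _.
rewrite [RHS](eq_bigr (fun v => \sum_(i | h i == u) \sum_(j | h j == v)
    c i * (c j)^* * K (y u) (y v))); last first.
  move=> v _; rewrite rmorph_sum /= !mulr_suml; apply: eq_bigr => i _.
  by rewrite mulr_sumr mulr_suml.
rewrite [RHS]exchange_big; apply: eq_bigr => i /eqP <-.
rewrite (partition_big h predT) //=; apply: eq_bigr => v _.
by apply: eq_bigr => j /eqP <-.
Qed.

Lemma fin_form_prod (T U : finType) (K : X -> X -> C) (y : T -> X)
    (a : T -> C) (b : U -> C) :
  fin_form K (fun p : T * U => y p.1) (fun p => a p.1 * b p.2) =
  `|\sum_t b t| ^+ 2 * fin_form K y a.
Proof.
rewrite (@fin_form_pushforward _ _ K fst y) -fin_form_scale; congr fin_form.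
apply/funext => u; rewrite mulr_suml.
rewrite (eq_bigl (fun p : T * U => (p.1 == u) && true)); last by move=> p; rewrite andbT.
rewrite -(pair_big (pred1 u) predT (fun i t => a i * b t)) /= big_pred1_eq.
by apply: eq_bigr => t _; rewrite mulrC.
Qed.

(** Serves to discard points at the origin, where the kernels of positive index vanish. *)
Lemma fin_form_sub (T : finType) (P : pred T) (K : X -> X -> C) (x : T -> X)
    (c : T -> C) :
  (forall i j, ~~ P i -> K (x i) (x j) = 0 /\ K (x j) (x i) = 0) ->
  fin_form K x c = fin_form K (fun i : {i | P i} => x (val i)) (c \o val).
Proof.
move=> K0; rewrite /fin_form -(@big_rmcond _ _ _ _ _ P) /=; last first.
  by move=> i /K0 Ki; rewrite big1 // => j _; rewrite (Ki j).1 mulr0.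
rewrite (big_sub (P : {pred T})); apply: eq_bigr => i _.
rewrite -(@big_rmcond _ _ _ _ _ P) /=; last first.
  by move=> j /K0 Kj; rewrite (Kj _).2 mulr0.
by rewrite (big_sub (P : {pred T})).
Qed.

End Forms.

(** The order may be partial, as on the complex numbers, so the norm is used: [u n - t] is
    eventually equal to its norm, hence so is its limit. *)
Lemma cvg_ge_num (K : numFieldType) (T : Type) (F : set_system T)
    {FF : ProperFilter F} (u : T -> K) (l t : K) :
  u @ F --> l -> (\forall n \near F, t <= u n) -> t <= l.
Proof.
move=> ul tu; have utl : (fun n => u n - t) @ F --> l - t.
  by apply: cvgB => //; exact: cvg_cst.
rewrite -subr_ge0; apply/normr_idP; apply: (cvg_unique (@norm_hausdorff _ _) (cvg_norm utl)).
apply: cvg_trans utl; apply: near_eq_cvg; near=> n.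
by rewrite ger0_norm // subr_ge0; near: n.
Unshelve. all: by end_near.
Qed.

(** * Polar coordinates in the plane and Chebyshev polynomials *)

Section Direction.
Variable R : realType.
Implicit Types (x y : 'cV[R]_2) (z w : Cplx R).

(** The value 1 at the origin is a convention that gives every point a direction of modulus 1. *)
Definition direction x : Cplx R :=
  if x == 0 then 1 else Complex (x 0 0 / enorm x) (x 1 0 / enorm x).

Definition polar (r : R) z : 'cV[R]_2 :=
  \col_i (r * if i == 0 then complex.Re z else complex.Im z).

Lemma dot2 x y : dot x y = x 0 0 * y 0 0 + x 1 0 * y 1 0.
Proof.
rewrite /dot !big_ord_recl big_ord0 addr0 (_ : lift ord0 ord0 = 1) //.
exact: val_inj.
Qed.

Lemma enorm_ge0 x : 0 <= enorm x. Proof. exact: sqrtr_ge0. Qed.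

Lemma sqr_enorm x : enorm x ^+ 2 = x 0 0 ^+ 2 + x 1 0 ^+ 2.
Proof. by rewrite sqr_sqrtr dot2 -!expr2 // addr_ge0 ?sqr_ge0. Qed.

Lemma col2P x y : x 0 0 = y 0 0 -> x 1 0 = y 1 0 -> x = y.
Proof.
move=> xy0 xy1; apply/colP => -[[|[|//]] i2].
  by rewrite (_ : Ordinal i2 = 0) //; exact: val_inj.
by rewrite (_ : Ordinal i2 = 1) //; exact: val_inj.
Qed.

Lemma enorm_eq0 x : (enorm x == 0) = (x == 0).
Proof.
apply/idP/eqP => [|->]; last by rewrite /enorm dot2 !mxE !mulr0 addr0 sqrtr0.
rewrite -sqrf_eq0 sqr_enorm paddr_eq0 ?sqr_ge0 // !sqrf_eq0 => /andP[/eqP x0 /eqP x1].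
by apply: col2P; rewrite mxE.
Qed.

Lemma enorm0 : enorm (0 : 'cV[R]_2) = 0.
Proof. by apply/eqP; rewrite enorm_eq0. Qed.

Lemma complex_conjE z : z^* = Complex (complex.Re z) (- complex.Im z).
Proof. by case: z. Qed.

Lemma complex_mulE z w : z * w =
  Complex (complex.Re z * complex.Re w - complex.Im z * complex.Im w)
          (complex.Re z * complex.Im w + complex.Im z * complex.Re w).
Proof. by case: z; case: w. Qed.

Lemma mul_conj_Re_Im z :
  z * z^* = (complex.Re z ^+ 2 + complex.Im z ^+ 2)%:C%C.
Proof. by rewrite complex_conjE complex_mulE /=; congr Complex; ring. Qed.

Lemma norm1_Re_Im z : `|z| = 1 -> complex.Re z ^+ 2 + complex.Im z ^+ 2 = 1.
Proof.
by move=> z1; have := mul_conj_Re_Im z; rewrite -normCK z1 expr1n => -[].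
Qed.

Lemma norm_direction x : `|direction x| = 1.
Proof.
apply/eqP; rewrite -(@eqrXn2 _ 2) // expr1n /direction; case: ifPn => [_|x0].
  by rewrite normr1 expr1n.
rewrite normCK mul_conj_Re_Im /= !expr_div_n -mulrDl -sqr_enorm divff //.
by rewrite sqrf_eq0 enorm_eq0.
Qed.

Lemma polarK x : polar (enorm x) (direction x) = x.
Proof.
rewrite /direction; case: ifPn => [/eqP ->|x0].
  by apply: col2P; rewrite !mxE enorm0 mul0r.
by apply: col2P; rewrite !mxE /= mulrC divfK ?enorm_eq0.
Qed.

Lemma enorm_polar r z : 0 <= r -> `|z| = 1 -> enorm (polar r z) = r.
Proof.
move=> r0 z1; apply/eqP; rewrite -(@eqrXn2 _ 2) ?enorm_ge0 // sqr_enorm !mxE /=.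
by rewrite !exprMn -mulrDr norm1_Re_Im // mulr1.
Qed.

Lemma direction_polar r z : 0 < r -> `|z| = 1 -> direction (polar r z) = z.
Proof.
move=> r0 z1; rewrite /direction -enorm_eq0 enorm_polar ?(ltW r0) // gt_eqF //.
by rewrite !mxE /= ![r * _]mulrC !mulfK ?gt_eqF //; case: (z).
Qed.

Lemma dot_direction x y : x != 0 -> y != 0 ->
  dot ((enorm x)^-1 *: x) ((enorm y)^-1 *: y) =
  complex.Re (direction x * (direction y)^*).
Proof.
move=> /negPf x0 /negPf y0; rewrite /direction x0 y0 complex_conjE complex_mulE /=.
by rewrite dot2 !mxE; ring.
Qed.

(** The right side satisfies the Chebyshev recurrence: multiplying [z ^+ n.+1 + z^* ^+ n.+1] by
    [z + z^*] gives the sum for [n.+2] plus [z * z^* = 1] times the sum for [n]. *)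
Lemma chebyshevT_Re z n : `|z| = 1 ->
  ((chebyshevT R n).[complex.Re z])%:C%C = (z ^+ n + z^* ^+ n) / 2.
Proof.
move=> z1; have zz : z * z^* = 1 by rewrite -normCK z1 expr1n.
have Re_z : (complex.Re z)%:C%C = (z + z^*) / 2 :> Cplx R.
  apply: (mulIf (_ : 2 != 0)); rewrite ?pnatr_eq0 // divfK ?pnatr_eq0 //.
  by rewrite mulr_natr mulr2n complex_conjE; case: (z) => a b; congr Complex => /=; ring.
suff: ((chebyshevT R n).[complex.Re z])%:C%C = (z ^+ n + z^* ^+ n) / 2 /\
  ((chebyshevT R n.+1).[complex.Re z])%:C%C = (z ^+ n.+1 + z^* ^+ n.+1) / 2 by case.
elim: n => [|n [IH0 IH1]].
  by rewrite !hornerE !expr0 !expr1 Re_z; split=> //; rewrite -mulr2n divff ?pnatr_eq0.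
split=> //; rewrite [chebyshevT _ _]/= hornerD hornerN hornerM hornerZ hornerX.
rewrite rmorphB rmorphM rmorphM rmorph_nat /= IH0 -/(chebyshevT R n.+1) IH1 Re_z.
have -> : z ^+ n = z * z^* * z ^+ n by rewrite zz mul1r.
have -> : z^* ^+ n = z * z^* * z^* ^+ n by rewrite zz mul1r.
by rewrite !exprS; field.
Qed.

End Direction.

(** * Series expansion of the quadratic form of [K] *)

Section Expansion.
Variables (R : realType) (K : 'cV[R]_2 -> 'cV[R]_2 -> Cplx R).
Variable alpha : nat -> R -> R -> Cplx R.
Hypothesis K_alpha : associated_kernels K alpha.
Implicit Types (x y : 'cV[R]_2).

Lemma enorm_nonneg x : nonneg (enorm x).
Proof. by rewrite /nonneg /= in_itv /= enorm_ge0. Qed.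

Lemma associated_series x y :
  series (fun n => alpha n (enorm x) (enorm y) *
    (((direction x * (direction y)^*) ^+ n + ((direction x)^* * direction y) ^+ n) / 2))
    @ \oo --> K x y.
Proof.
have [xy0|] := pselect (x = 0 \/ y = 0).
  (* At the origin only the term of index 0 survives, so the partial sums are constant as soon as
     they contain it, that is from 1 on. *)
  rewrite (assoc_zero K_alpha xy0); apply: cvg_near_cst; exists 1%N => // -[//|n] _.
  rewrite /series /= big_nat_recl // !expr0 -mulr2n divff ?pnatr_eq0 // mulr1.
  rewrite big1_seq ?addr0 // => k _; case: xy0 => ->; rewrite enorm0.
    by rewrite (assoc_origin K_alpha _ (enorm_nonneg y)).2 // mul0r.
  by rewrite (assoc_origin K_alpha _ (enorm_nonneg x)).1 // mul0r.
move=> /not_orP[/eqP x0 /eqP y0].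
apply: cvg_trans (assoc_series K_alpha x0 y0); apply: near_eq_cvg; apply: nearW => n.
apply: eq_bigr => k _; congr (_ * _).
rewrite dot_direction // chebyshevT_Re ?normrM ?norm_conjC ?norm_direction ?mulr1 //.
by rewrite rmorphM /= conjCK.
Qed.

Section Form.
Variables (T : finType) (x : T -> 'cV[R]_2) (c : T -> Cplx R).
Let r i := enorm (x i).
Let d i := direction (x i).

Definition form_term n : Cplx R :=
  (fin_form (alpha n) r (fun i => c i * d i ^+ n) +
   fin_form (alpha n) r (fun i => c i * (d i)^* ^+ n)) / 2.

Lemma fin_form_associated_ge0 n (b : T -> Cplx R) : 0 <= fin_form (alpha n) r b.
Proof.
apply: fin_form_ge0 (assoc_pos_def K_alpha n) _ => i.
exact: enorm_nonneg.
Qed.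

Lemma form_term_ge0 n : 0 <= form_term n.
Proof. by rewrite divr_ge0 // addr_ge0 // fin_form_associated_ge0. Qed.

(** The powers of [d i] and of the conjugate of [d j] are absorbed into the weights, which turns
    each term of the double sum into quadratic forms of [alpha n]. *)
Lemma form_series : series form_term @ \oo --> fin_form K x c.
Proof.
pose s i j := series (fun n => alpha n (r i) (r j) *
    (((d i * (d j)^*) ^+ n + ((d i)^* * d j) ^+ n) / 2)).
have -> : series form_term =
    (fun n => \sum_i \sum_j c i * (c j)^* * s i j n).
  apply/funext => n; rewrite /series /=.
  under [RHS]eq_bigr do under eq_bigr do rewrite mulr_sumr.
  under [RHS]eq_bigr do rewrite exchange_big.
  rewrite exchange_big; apply: eq_bigr => k _ /=.
  rewrite /form_term -big_split /= mulr_suml; apply: eq_bigr => i _.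
  rewrite -big_split /= mulr_suml; apply: eq_bigr => j _.
  by rewrite !rmorphM !rmorphXn /= conjCK !exprMn; ring.
apply: (cvg_big add_continuous) => i _; apply: (cvg_big add_continuous) => j _.
by apply: cvgMl_tmp; exact: associated_series.
Qed.

Lemma form_ge_term n : form_term n <= fin_form K x c.
Proof.
apply: (cvg_ge_num form_series); exists n.+1 => // m /= nm.
rewrite /series /= (bigD1_seq n) ?mem_index_iota ?iota_uniq //= lerDl.
by apply: sumr_ge0 => k _; exact: form_term_ge0.
Qed.

Lemma form_eq0 : (forall n, form_term n = 0) -> fin_form K x c = 0.
Proof.
move=> t0; apply: (cvg_unique (@norm_hausdorff _ _) form_series).
apply: cvg_near_cst; apply: nearW => n.
by rewrite /series /= big1.
Qed.

End Form.
End Expansion.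

(** * The necessary conditions *)

Section Necessary.
Variables (R : realType) (K : 'cV[R]_2 -> 'cV[R]_2 -> Cplx R).
Variable alpha : nat -> R -> R -> Cplx R.
Hypothesis K_alpha : associated_kernels K alpha.

Lemma positP (r : R) : posit r <-> 0 < r.
Proof. by rewrite /posit /= in_itv /= andbT. Qed.

Lemma posit_nonneg (r : R) : posit r -> nonneg r.
Proof. by move/positP => /ltW r0; rewrite /nonneg /= in_itv /= r0. Qed.

Lemma strict_origin : strictly_pos_def_on setT K -> 0 < alpha 0%N 0 0.
Proof.
move=> spdK; have := @fin_form_gt0 _ _ _ unit _ (fun=> 0) (fun=> 1) tt spdK.
rewrite /fin_form !big_const card_unit /= !addr0 rmorph1 !mul1r.
rewrite (assoc_zero K_alpha) ?enorm0; last by left.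
by apply=> //; move=> [] [].
Qed.

(** Source of both necessary conditions. If it failed, the form of [K] at suitably weighted regular
    k-gons of radii [r i] would vanish. *)
Lemma strict_progression (m : nat) (r : 'I_m -> R) (c : 'rV[Cplx R]_m) (S : set int) :
  strictly_pos_def_on setT K ->
  (forall i, posit (r i)) -> injective r -> c != 0 -> full_progression S ->
  exists2 n : int, S n & 0 < kernel_form (alpha `|n|%N) r c.
Proof.
move=> spdK r_pos r_inj c0 [k [p [k0 pk SE]]]; apply: contrapT => noS.
have r0 i : 0 < r i by apply/positP.
have formS n : S n -> fin_form (alpha `|n|%N) r (c 0) = 0.
  move=> Sn; apply/eqP; apply: contra_notT noS => form0; exists n => //.
  rewrite lt_def -[kernel_form _ _ _]/(fin_form _ _ _) form0 /=.
  by apply: fin_form_ge0 (assoc_pos_def K_alpha _) _ => i; exact: posit_nonneg.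
have [w w_prim] := prim_root_exists (Cplx R) k0.
have wk : w ^+ k = 1 by exact: prim_expr_order.
have w1 : `|w| = 1.
  by apply/eqP; rewrite -(@eqrXn2 _ k) // -normrX wk normr1 expr1n.
have ww : w * w^* = 1 by rewrite -normCK w1 expr1n.
have norm_wX t : `|w ^+ t| = 1 by rewrite normrX w1 expr1n.
pose x (it : 'I_m * 'I_k) := polar (r it.1) (w ^+ it.2).
have xE : (fun it => enorm (x it)) = (fun it => r it.1).
  by apply/funext => it; rewrite enorm_polar // ltW.
have dE it : direction (x it) = w ^+ it.2 by rewrite direction_polar.
have x_inj : injective x.
  move=> [i t] [j u] xij; have /r_inj /= ij : r (i, t).1 = r (j, u).1.
    by rewrite -[LHS](congr1 (fun f => f (i, t)) xE) xij
               (congr1 (fun f => f (j, u)) xE).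
  have := dE (i, t); rewrite xij dE /= => /eqP.
  rewrite (eq_prim_root_expr w_prim) !modn_small // => /eqP ut.
  by rewrite ij; congr pair; apply: val_inj.
pose b (it : 'I_m * 'I_k) := c 0 it.1 * (w^* ^+ p) ^+ it.2.
have /rV0Pn[i0 ci0] := c0.
have b0 : b (i0, Ordinal k0) != 0 by rewrite mulf_neq0 // expr0 oner_neq0.
have := fin_form_gt0 spdK (fun=> I) x_inj b0.
rewrite (form_eq0 K_alpha) ?ltxx // => n.
(* The form factors through the geometric sum of the powers of [w^* ^+ p * v], which is zero unless
   that root of unity is 1. It is applied to [v = w ^+ n] and to its conjugate. *)
have part v : v ^+ k = 1 -> (w^* ^+ p * v = 1 -> fin_form (alpha n) r (c 0) = 0) ->
    fin_form (alpha n) (fun it => r it.1) (fun it => b it * v ^+ it.2) = 0.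
  move=> vk v0.
  have -> : (fun it => b it * v ^+ it.2) =
      (fun it : 'I_m * 'I_k => c 0 it.1 * (w^* ^+ p * v) ^+ it.2).
    by apply/funext => it; rewrite /b exprMn mulrA.
  rewrite (fin_form_prod (alpha n) r (c 0) (fun t : 'I_k => (w^* ^+ p * v) ^+ t)).
  have [/v0 ->|v1] := eqVneq (w^* ^+ p * v) 1; first by rewrite mulr0.
  rewrite geometric_sum_eq0 ?normr0 ?expr0n ?mul0r // exprMn vk mulr1.
  by rewrite exprAC -rmorphXn /= wk rmorph1 expr1n.
rewrite /form_term xE.
rewrite (_ : (fun it => b it * direction (x it) ^+ n) =
             (fun it => b it * (w ^+ n) ^+ it.2)); last first.
  by apply/funext => it; rewrite dE exprAC.
rewrite (_ : (fun it => b it * (direction (x it))^* ^+ n) =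
             (fun it => b it * (w^* ^+ n) ^+ it.2)); last first.
  by apply/funext => it; rewrite dE rmorphXn exprAC.
rewrite !part ?addr0 ?mul0r //.
- by rewrite exprAC -rmorphXn /= wk rmorph1 expr1n.
(* For the conjugate, the exceptional case says that k divides [n + p], so [- n] lies in [S]. *)
- rewrite -exprD -rmorphXn /= => /(congr1 Num.conj); rewrite conjCK rmorph1 => /eqP.
  rewrite -(prim_order_dvd w_prim) => /dvdnP[q pn].
  rewrite -(absz_nat n) -abszN formS // SE; exists (- q%:Z).
  by rewrite mulrN -PoszM mulnC -pn PoszD opprD addrAC addNr add0r.
- by rewrite exprAC wk expr1n.
(* Here the exceptional case is [n] congruent to [p] modulo k, so [n] itself lies in [S]. *)
- move=> wpn; have /eqP : w ^+ n = w ^+ p.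
    by rewrite -[RHS]mulr1 -wpn mulrA -exprMn ww expr1n mul1r.
  rewrite (eq_prim_root_expr w_prim) (modn_small pk) => /eqP np.
  rewrite -(absz_nat n) formS // SE; exists (n %/ k)%N%:Z.
  by rewrite -PoszM -PoszD mulnC -np -divn_eq.
Qed.

End Necessary.

(** * Unconditional sums over sets of integers *)

Local Notation partial_sum := summability.partial_sum.
Local Notation totally := summability.totally.
Local Existing Instance summability.totally_filter.

Lemma ler_sum_subset (V : numDomainType) (I : eqType) (s t : seq I) (f : I -> V) :
  (forall i, 0 <= f i) -> uniq s -> {subset s <= t} ->
  \sum_(i <- s) f i <= \sum_(i <- t) f i.
Proof.
move=> f0; elim: s t => [|i s IHs] t /=; first by rewrite big_nil sumr_ge0.
move=> /andP[si us] st; have it : i \in t by rewrite st ?mem_head.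
rewrite big_cons (big_rem i it) /= lerD2l IHs // => j js.
by rewrite rem_mem ?st ?in_cons ?js ?orbT //; apply: contraNneq si => <-.
Qed.

(** Each absolute value is attained by at most two integers, whence the factor 2. *)
Lemma ler_sum_absz (V : numDomainType) (a : nat -> V) (M : V) (s : seq int) :
  (forall n, 0 <= a n) -> (forall N, \sum_(0 <= n < N) a n <= M) -> uniq s ->
  \sum_(n <- s) a `|n|%N <= M *+ 2.
Proof.
move=> a0 aM us; pose N := (\max_(n <- s) `|n|%N).+1.
pose t := map Posz (iota 0 N) ++ map (fun n => - n%:Z) (iota 0 N).
apply: (@le_trans _ _ (\sum_(n <- t) a `|n|%N)).
  apply: ler_sum_subset => // n ns.
  have nN : `|n|%N \in iota 0 N by rewrite mem_iota /= add0n ltnS leq_bigmax_seq.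
  rewrite mem_cat; case: (intP n) ns nN => [|m|m] _ nN.
  - by rewrite map_f.
  - by rewrite (map_f Posz nN).
  - by apply/orP; right; apply/mapP; exists m.+1.
rewrite big_cat !big_map mulr2n lerD //=.
  by have := aM N; rewrite /index_iota subn0.
by under eq_bigr do rewrite abszN; have := aM N; rewrite /index_iota subn0.
Qed.

Lemma partial_sum_seq (I : choiceType) (V : zmodType) (f : I -> V) (A : {fset I}) :
  partial_sum f A = \sum_(i <- A) f i.
Proof. by rewrite /partial_sum [RHS]big_seq_fsetE. Qed.

Lemma near_totally (I : choiceType) (A : {fset I}) (P : set {fset I}) :
  (forall B, (A `<=` B)%fset -> P B) -> \forall B \near totally, P B.
Proof. by move=> AP; exists A. Qed.

(** Monotone convergence along finite subsets: the partial sums are real and increasing, and tend to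
    the supremum of their real parts. *)
Lemma cvg_partial_sum_bounded (R : realType) (I : choiceType) (f : I -> Cplx R) (M : Cplx R) :
  (forall i, 0 <= f i) -> (forall A, partial_sum f A <= M) ->
  cvg (partial_sum f @ totally).
Proof.
move=> f0 fM; pose g A := complex.Re (partial_sum f A).
have fg A : partial_sum f A = (g A)%:C%C.
  by rewrite /g RRe_real // ger0_real // sumr_ge0.
have g_le A B : (A `<=` B)%fset -> g A <= g B.
  move=> /fsubsetP AB; rewrite -lecR -!fg !partial_sum_seq.
  exact: ler_sum_subset.
have has_sup_g : has_sup (range g).
  split; first by exists (g fset0), fset0.
  exists (complex.Re M) => _ [A _ <-].
  by have := fM A; rewrite lecE => /andP[].
apply: (cvgP ((sup (range g))%:C%C : Cplx R)).
apply/cvgrPdist_lt => e e0.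
have /andP[_ e0'] : (complex.Im e == 0) && (0 < complex.Re e).
  by move: e0; rewrite ltcE.
have eE : e = (complex.Re e)%:C%C by rewrite RRe_real // gtr0_real.
have [_ [A _ <-] gA] := sup_adherent e0' has_sup_g.
apply: (@near_totally _ A) => B /g_le gAB.
have gB : g B <= sup (range g) by apply: sup_upper_bound => //; exists B.
rewrite fg -rmorphB /= ger0_norm ?ler0c ?subr_ge0 // eE ltcR.
by rewrite ltrBlDr -ltrBlDl (lt_le_trans _ gAB) // addrC.
Qed.

Section Progression.
Variables (R : realType) (K : 'cV[R]_2 -> 'cV[R]_2 -> Cplx R).
Variable alpha : nat -> R -> R -> Cplx R.
Hypothesis K_alpha : associated_kernels K alpha.
Implicit Types (r s : R) (S : set int).

Lemma associated_diag_ge0 n r : nonneg r -> 0 <= alpha n r r.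
Proof.
move=> r0; have := @fin_form_ge0 _ _ _ unit _ (fun=> r) (fun=> 1) (assoc_pos_def K_alpha n).
rewrite /fin_form !big_const card_unit /= !addr0 rmorph1 !mul1r; exact.
Qed.

(** Convergence of the suprema to 0 makes one of them finite; it bounds a tail at [r], and finitely
    many terms remain. *)
Lemma associated_diag_bounded r : nonneg r ->
  exists M : Cplx R, forall N, \sum_(0 <= n < N) alpha n r r <= M.
Proof.
move=> r0; have [U [_ Ur]] := assoc_locally_uniform K_alpha r0.
have {}Ur : U r by exact: nbhs_singleton Ur r0.
move=> /fine_cvgP[[N _ /(_ N (leqnn N))/= fin_sup] _].
set T := ereal_sup _ in fin_sup.
have a0 n : 0 <= complex.Re (alpha n r r).
  by have := associated_diag_ge0 n r0; rewrite lecE => /andP[].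
have aE n : alpha n r r = (complex.Re (alpha n r r))%:C%C.
  by rewrite RRe_real // ger0_real // associated_diag_ge0.
have tail m : \sum_(N <= n < m) complex.Re (alpha n r r) <= fine T.
  rewrite -lee_fin fineK // -sumEFin; apply: (@le_trans _ _
    (\sum_(N <= n <oo) (complex.Re (alpha n r r))%:E)%E).
    by apply: nneseries_lim_ge => n _ _; rewrite lee_fin.
  by apply: ereal_sup_ubound; exists r.
exists (\sum_(0 <= n < N) complex.Re (alpha n r r) + fine T)%:C%C => m.
under eq_bigr do rewrite aE.
rewrite -rmorph_sum lecR.
apply: (@le_trans _ _ (\sum_(0 <= n < N + m) complex.Re (alpha n r r))).
  rewrite (@big_cat_nat _ _ _ m _ (N + m)) ?leq_addl //= lerDl.
  by apply: sumr_ge0.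
by rewrite (@big_cat_nat _ _ _ N) ?leq_addr //= lerD2l.
Qed.

Lemma progression_kernel_cvg S r s : nonneg r -> nonneg s ->
  partial_sum (fun n : int => if n \in S then alpha `|n|%N r s else 0) @ totally
    --> progression_kernel alpha S r s.
Proof.
move=> r0 s0.
(* [progression_kernel] is defined as the limit of these partial sums, so their convergence is
   enough. *)
suff : cvg (partial_sum (fun n : int => if n \in S then alpha `|n|%N r s else 0) @ totally).
  by [].
pose q n (b : Cplx R) :=
  fin_form (alpha n) (fun t : bool => if t then r else s) (fun t => if t then 1 else b).
have qE n b : q n b = alpha n r r + b^* * alpha n r s + b * alpha n s r +
    b * b^* * alpha n s s.
  by rewrite /q /fin_form !big_bool /= rmorph1; ring.
have q0 n b : 0 <= q n b.
  by apply: fin_form_ge0 (assoc_pos_def K_alpha n) _ => -[].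
(* Polarization: 4 alpha_n(r, s) is the sum of b q_n(b) over b^4 = 1, which
   reduces the convergence to that of bounded nonnegative families. *)
have [Mr aMr] := associated_diag_bounded r0.
have [Ms aMs] := associated_diag_bounded s0.
have q_le n b : `|b| = 1 -> q n b <= (alpha n r r + alpha n s s) *+ 2.
  move=> b1; have bb : b * b^* = 1 by rewrite -normCK b1 expr1n.
  (* Parallelogram identity: the cross terms of [b] and [- b] cancel. *)
  apply: (@le_trans _ _ (q n b + q n (- b))); first by rewrite lerDl.
  by rewrite le_eqVlt !qE rmorphN /= mulrNN bb; apply/orP; left; apply/eqP; ring.
have q_cvg b : `|b| = 1 ->
    cvg (partial_sum (fun n : int => if n \in S then q `|n|%N b else 0) @ totally).
  move=> b1; apply: (@cvg_partial_sum_bounded _ _ _ ((Mr + Ms) *+ 2 *+ 2)).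
    by move=> n; case: ifP.
  move=> A; rewrite partial_sum_seq.
  apply: (@le_trans _ _ (\sum_(n <- A) (fun m => (alpha m r r + alpha m s s) *+ 2) `|n|%N)).
    apply: ler_sum => n _; case: ifP => _; first exact: q_le.
    by rewrite mulrn_wge0 // addr_ge0 // associated_diag_ge0.
  apply: (@ler_sum_absz _ (fun m => (alpha m r r + alpha m s s) *+ 2)) => [n|N|];
    last exact: fset_uniq.
    by rewrite mulrn_wge0 // addr_ge0 // associated_diag_ge0.
  by rewrite sumrMnl lerMn2r /= big_split lerD.
have -> : partial_sum (fun n : int => if n \in S then alpha `|n|%N r s else 0) =
    (fun A => \sum_(b <- [:: 1; -1; 'i; - 'i]) b / 4 *
      partial_sum (fun n : int => if n \in S then q `|n|%N b else 0) A).
  apply/funext => A; under [RHS]eq_bigr do rewrite mulr_sumr.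
  rewrite exchange_big; apply: eq_bigr => n _ /=; case: ifP => _; last first.
    by rewrite big1 // => b _; rewrite mulr0.
  rewrite !big_cons big_nil addr0 !qE.
  rewrite !rmorphN rmorph1 /= conjCi.
  by have := sqrCi (Cplx R); set j := ('i : Cplx R) => jj; field: jj.
apply: (cvgP (\sum_(b <- [:: 1; -1; 'i; - 'i]) b / 4 *
  lim (partial_sum (fun n : int => if n \in S then q `|n|%N b else 0) @ totally))).
rewrite big_seq; under eq_fun do rewrite big_seq.
apply: (cvg_big add_continuous) => b bs; apply: cvgMl_tmp; apply: q_cvg.
move: bs; rewrite !inE => /or4P[] /eqP ->; by rewrite ?normrN ?normr1 ?normCi.
Qed.

Lemma kernel_form_progression_cvg S m (r : 'I_m -> R) (c : 'rV[Cplx R]_m) :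
  (forall i, nonneg (r i)) ->
  partial_sum (fun n : int => if n \in S then kernel_form (alpha `|n|%N) r c else 0)
    @ totally --> kernel_form (progression_kernel alpha S) r c.
Proof.
move=> r0.
have -> : partial_sum (fun n : int => if n \in S then kernel_form (alpha `|n|%N) r c else 0) =
    (fun A => \sum_i \sum_j c 0 i * (c 0 j)^* *
      partial_sum (fun n : int => if n \in S then alpha `|n|%N (r i) (r j) else 0) A).
  apply/funext => A.
  under [RHS]eq_bigr do under eq_bigr do rewrite mulr_sumr.
  under [RHS]eq_bigr do rewrite exchange_big.
  rewrite exchange_big; apply: eq_bigr => n _ /=; case: ifP => // _.
  by rewrite big1 // => i _; rewrite big1 // => j _; rewrite mulr0.
apply: (cvg_big add_continuous) => i _; apply: (cvg_big add_continuous) => j _.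
by apply: cvgMl_tmp; exact: progression_kernel_cvg.
Qed.

Lemma kernel_form_progression_ge S m (r : 'I_m -> R) (c : 'rV[Cplx R]_m) n :
  (forall i, nonneg (r i)) -> S n ->
  kernel_form (alpha `|n|%N) r c <= kernel_form (progression_kernel alpha S) r c.
Proof.
move=> r0 Sn; apply: (cvg_ge_num (@kernel_form_progression_cvg S _ _ c r0)).
apply: (@near_totally _ [fset n]%fset) => B; rewrite fsub1set => nB.
rewrite partial_sum_seq (big_fsetD1 n) //= mem_set // lerDl.
apply: sumr_ge0 => k _; case: ifP => // _; exact: (assoc_pos_def K_alpha).
Qed.

Lemma progression_kernel_pos_def S : pos_def_on (@nonneg R) (progression_kernel alpha S).
Proof.
move=> m r c r0; apply: (cvg_ge_num (@kernel_form_progression_cvg S _ _ c r0)).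
apply: nearW => A; apply: sumr_ge0 => k _; case: ifP => // _.
exact: (assoc_pos_def K_alpha).
Qed.

End Progression.

(** * The sufficient condition *)

Section Sufficient.
Variables (R : realType) (K : 'cV[R]_2 -> 'cV[R]_2 -> Cplx R).
Variable alpha : nat -> R -> R -> Cplx R.
Hypothesis K_alpha : associated_kernels K alpha.

(** Drop the points at the origin and merge those of equal norm: the radii become distinct and
    positive, and the weight at [rho] is the nonzero sum. *)
Lemma fin_form_radial_gt0 (T : finType) (x : T -> 'cV[R]_2) (c : T -> Cplx R) n rho :
  (0 < n)%N -> strictly_pos_def_on (@posit R) (alpha n) -> 0 < rho ->
  \sum_(i | enorm (x i) == rho) c i != 0 ->
  0 < fin_form (alpha n) (fun i => enorm (x i)) c.
Proof.
move=> n0 spd rho0 sum0; pose P i := 0 < enorm (x i).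
rewrite (@fin_form_sub _ _ _ P); last first.
  move=> i j; rewrite /P lt_neqAle enorm_ge0 andbT negbK => /eqP <-.
  by case: (assoc_origin K_alpha n0 (enorm_nonneg (x j))).
pose T' := {i | P i}; pose r (i : T') := enorm (x (val i)).
pose h i : seq_sub (codom r) := SeqSub (codom_f r i).
rewrite (fin_form_pushforward (alpha n) h (@ssval _ (codom r))).
have sumE (u : seq_sub (codom r)) : ssval u = rho ->
    \sum_(i | h i == u) (c \o val) i = \sum_(i | enorm (x i) == rho) c i.
  move=> urho; rewrite (eq_bigl (fun i : T' => enorm (x (val i)) == rho)); last first.
    by move=> i; rewrite -urho.
  rewrite -(big_sub_cond (P : {pred T}) (fun i => enorm (x i) == rho)) /=.
  apply: eq_bigl => i; rewrite andb_idl // => /eqP xi.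
  by rewrite unfold_in /P xi.
have [i0 xi0] : exists i0, enorm (x i0) == rho.
  by apply: contra_notP (elimN eqP sum0) => ni; rewrite big1 // => i xi; case: ni; exists i.
have Pi0 : P i0 by rewrite /P (eqP xi0).
apply: (@fin_form_gt0 _ _ _ _ _ _ _ (h (exist _ i0 Pi0)) spd).
- move=> u; apply/positP; have /codomP[i ->] := ssvalP u; exact: valP i.
- exact: val_inj.
- by rewrite sumE //= /r /=; exact/eqP.
Qed.

Lemma strict_sufficient :
  0 < alpha 0%N 0 0 ->
  (forall S : set int, full_progression S ->
    exists2 n, S n & strictly_pos_def_on (@posit R) (alpha `|n|%N)) ->
  forall (T : finType) (x : T -> 'cV[R]_2) (c : T -> Cplx R) i0,
    injective x -> c i0 != 0 -> 0 < fin_form K x c.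
Proof.
move=> alpha0 spd T x c i0 x_inj ci0.
(* If no point away from the origin carries weight, injectivity leaves the single index [i0], and
   the form is a positive multiple of [alpha 0 0 0]. *)
have [[i1 ci1 xi1]|zero_supp] := pselect (exists2 i, c i != 0 & x i != 0); last first.
  have c0 i : i != i0 -> c i = 0.
    move=> ii0; apply/eqP; apply: contra_notT zero_supp => ci.
    have [xi|xi] := eqVneq (x i) 0; last by exists i.
    exists i0 => //; rewrite -xi; apply: contra_neq ii0 => /x_inj //.
  have xi0 : x i0 = 0.
    by apply/eqP; apply: contra_notT zero_supp => xi0; exists i0.
  rewrite /fin_form (bigD1 i0) //= [X in _ + X]big1 ?addr0; last first.
    by move=> i /c0 ->; rewrite big1 // => j _; rewrite !mul0r.
  rewrite (bigD1 i0) //= big1 ?addr0; last first.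
    by move=> i /c0 ->; rewrite rmorph0 mulr0 mul0r.
  rewrite xi0 (assoc_zero K_alpha) ?enorm0; last by left.
  by rewrite mulr_gt0 // -normCK exprn_gt0 // normr_gt0.
pose rho := enorm (x i1); pose d i := direction (x i).
have rho0 : 0 < rho by rewrite lt_neqAle enorm_ge0 eq_sym enorm_eq0 xi1.
have d0 i : d i != 0 by rewrite -normr_eq0 norm_direction oner_neq0.
have dV i : (d i)^-1 = (d i)^*.
  by apply: (mulfI (d0 i)); rewrite divff // -normCK norm_direction expr1n.
(* On one circle, distinct points have distinct directions. *)
have [n0] : exists n : nat, \sum_(i | enorm (x i) == rho) c i * d i ^+ n != 0.
  apply: (@exponential_sum_neq0 _ _ _ _ _ i1) => // i j.
  rewrite !unfold_in => /eqP xi /eqP xj dij; apply: x_inj.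
  by rewrite -[x i]polarK -[x j]polarK xi xj [direction _]dij.
pose c' i := if enorm (x i) == rho then c i else 0.
have c'E n : \sum_i c' i * d i ^ n = \sum_(i | enorm (x i) == rho) c i * d i ^ n.
  rewrite [RHS]big_mkcond; apply: eq_bigr => i _; rewrite /c'.
  by case: ifP => // _; rewrite mul0r.
rewrite -[X in X != 0](c'E n0%:Z) => /(power_sum_progression_neq0 d0)[k k0 fk].
(* The subprogression k1 Z + n1 avoids 0, where the point x = 0 would interfere. *)
pose n1 := (n0 + k)%N; pose k1 := (k * n1.+1)%N.
have n1k1 : (n1 < k1)%N by rewrite -[X in (X <= _)%N]mul1n leq_mul2r.
have [|n [q nE] spdn] := spd [set n | exists q : int, n = k1%:Z * q + n1%:Z].
  by exists k1, n1; rewrite (leq_ltn_trans _ n1k1).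
have n_gt0 : (0 < `|n|)%N.
  rewrite absz_gt0 nE; apply: contraTneq n1k1 => /eqP.
  rewrite addrC addr_eq0 => /eqP/(congr1 absz); rewrite abszN abszM !absz_nat => n1E.
  rewrite -leqNgt dvdn_leq //; first by rewrite /n1 addn_gt0 k0 orbT.
  by rewrite n1E dvdn_mulr.
have fn : \sum_(i | enorm (x i) == rho) c i * d i ^ n != 0.
  (* Indeed k1 q + n1 = k ((n1 + 1) q + 1) + n0, so [n] lies in the progression free of zeros. *)
  have := fk (n1.+1%:Z * q + 1); rewrite c'E mulrDr mulr1 mulrA -PoszM.
  by rewrite -addrA -PoszD [(k + n0)%N]addnC -nE.
apply: lt_le_trans (form_ge_term K_alpha x c `|n|%N).
have form_gt0 (v : T -> Cplx R) : (forall i, v i = d i ^ n) ->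
    0 < fin_form (alpha `|n|%N) (fun i => enorm (x i)) (fun i => c i * v i).
  move=> vE; apply: (fin_form_radial_gt0 n_gt0 spdn rho0).
  by under eq_bigr do rewrite vE.
have form_ge0 := fin_form_associated_ge0 K_alpha x `|n|%N.
(* For [n] nonnegative the first half of [form_term] is positive; for [n] negative it is the second,
   since the conjugate of [d i] is its inverse. *)
rewrite divr_gt0 //; case: n form_gt0 form_ge0 {nE spdn n_gt0 fn} => n form_gt0 form_ge0.
  by rewrite ltr_pwDl // form_gt0.
by rewrite ltr_wpDl // form_gt0 // => i; rewrite NegzE -exprz_inv dV.
Qed.

End Sufficient.

Theorem theorem3p2 (R : realType) (K : 'cV[R]_2 -> 'cV[R]_2 -> Cplx R)
    (alpha : nat -> R -> R -> Cplx R)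
    (K_continuous : continuous (fun p : 'cV[R]_2 * 'cV[R]_2 => K p.1 p.2))
    (K_isotropic : isotropic K)
    (K_pos_def : pos_def_on setT K)
    (K_alpha : associated_kernels K alpha) :
  [/\ (strictly_pos_def_on setT K ->
        0 < alpha 0%N 0 0 /\
        forall (m : nat) (r : 'I_m -> R) (c : 'rV[Cplx R]_m),
          (forall i, posit (r i)) -> injective r -> c != 0 ->
          forall S : set int, full_progression S ->
            [set n : int | 0 < kernel_form (alpha `|n|%N) r c] `&` S !=set0),
      (strictly_pos_def_on setT K ->
        0 < alpha 0%N 0 0 /\
        forall S : set int, full_progression S ->
          strictly_pos_def_on (@posit R) (progression_kernel alpha S)) &
      (0 < alpha 0%N 0 0 /\
        (forall S : set int, full_progression S ->
          [set n : int | strictly_pos_def_on (@posit R) (alpha `|n|%N)]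
            `&` S !=set0) ->
        strictly_pos_def_on setT K)].
Proof.
split.
- move=> spdK; split; first exact: (strict_origin K_alpha).
  move=> m r c r_pos r_inj c0 S fS.
  have [n Sn form_n] := strict_progression K_alpha spdK r_pos r_inj c0 fS.
  by exists n.
- move=> spdK; split; first exact: (strict_origin K_alpha).
  move=> S fS; split=> [|m r c r_pos r_inj c0].
    move=> m r c r_pos; apply: (progression_kernel_pos_def K_alpha) => i.
    exact: posit_nonneg.
  have [n Sn form_n] := strict_progression K_alpha spdK r_pos r_inj c0 fS.
  apply: lt_le_trans form_n _; apply: (kernel_form_progression_ge K_alpha) => // i.
  exact: posit_nonneg.
- move=> [alpha0 spd]; split=> // m x c _ x_inj /rV0Pn[i0 ci0].
  apply: (strict_sufficient K_alpha alpha0 _ x_inj ci0) => S /spd[n [spdn Sn]].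
  by exists n.
Qed.
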